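(* Assume that for each task $q\in\mathcal{Q}$ not all agents are dominating for $q$. Let $\mathcal O$ be the set of all solutions $\mathcal P^*=(\mathcal V_1^*,\dots,\mathcal V_n^* )$ of the task-partition problem $$\max_{(\mathcal V_1,\dots,\mathcal V_n),\ \mathcal V_i\subseteq\mathcal Q}\ \sum_{i\in\mathcal A}\sum_{q\in\mathcal V_i}f_i(q)\quad\text{subject to}\quad \bigcup_{i\in\mathcal A}\mathcal V_i=\mathcal Q,\quad \mathcal V_i\cap\mathcal V_j=\varnothing\ \text{ for } i\ne j .$$ Then $\mathcal O\subseteq C(\mathcal{NE}(\mathcal G_W))$, where $\mathcal{NE}(\mathcal G_W)$ is the set of Nash equilibria of the weight game $\mathcal G_W$ and $C(\mathcal{NE}(\mathcal G_W))$ is its image under the translated-support map $C$.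
   Context: $\mathcal A=\{1,\dots,n\}$ is a finite set of agents and $\mathcal Q=\{1,\dots,m\}$ a finite set of tasks. For each $i\in\mathcal A$, $f_i:\mathcal Q\to\mathbb R_{\ge 0}$ is a given function. Agent $i$ is dominating for task $q$ if $f_i(q)\ge f_j(q)$ for all $j\in\mathcal A$. The weight game $\mathcal G_W$ is the strategic form game in which agent $i\in\mathcal A$ chooses a weight vector $\mathbf w_i=(w_i^q)_{q\in\mathcal Q}\in[0,1]^m$. A profile is a matrix $\mathbf W=(w_i^q)\in[0,1]^{n\times m}$. The utility of agent $i$ is $$U_i(\mathbf w_i,\mathbf w_{-i})=\sum_{q\in\mathcal Q}\Big[f_i(q)w_i^q-\max_{j\in\mathcal A\setminus\{i\}}f_j(q)w_j^q\,w_i^q\Big].$$ A profile $(\hat{\mathbf w}_i,\hat{\mathbf w}_{-i})$ is a Nash equilibrium if $U_i(\hat{\mathbf w}_i,\hat{\mathbf w}_{-i})\ge U_i(\mathbf w_i,\hat{\mathbf w}_{-i})$ for all $\mathbf w_i\in[0,1]^m$ and all $i\in\mathcal A$. The map $C:[0,1]^{n\times m}\to(2^{\mathcal Q})^n$ is $C(\mathbf W)=(\mathrm{tsupp}\,\mathbf w_1,\dots,\mathrm{tsupp}\,\mathbf w_n)$, where $\mathrm{tsupp}\,\mathbf w_i=\{q\in\mathcal Q: w_i^q=1\}$. *)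

(* Defs.v *)
From HB Require Import structures.
From mathcomp Require Import all_boot all_order all_algebra.
From mathcomp Require Import classical_sets reals.

Set Implicit Arguments.
Unset Strict Implicit.
Unset Printing Implicit Defensive.

Import Order.TTheory GRing.Theory Num.Theory.
Local Open Scope ring_scope.
Local Open Scope classical_set_scope.

Definition dominating (R : realType) (n m : nat) (f : 'I_n -> 'I_m -> R)
    (i : 'I_n) (q : 'I_m) : Prop :=
  forall j : 'I_n, f j q <= f i q.

Definition weight_vectors (R : realType) (m : nat) : set 'rV[R]_m :=
  [set w : 'rV[R]_m | forall q : 'I_m, 0 <= w 0 q <= 1].

Definition weight_profiles (R : realType) (n m : nat) : set 'M[R]_(n, m) :=
  [set W : 'M[R]_(n, m) | forall i : 'I_n, weight_vectors (row i W)].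

(* U_i(w, W_{-i}): only the rows of W other than i are used.  The default
   value 0 of the maximum is immaterial as soon as there are at least two
   agents, because f and the weights are nonnegative. *)
Definition utility (R : realType) (n m : nat) (f : 'I_n -> 'I_m -> R)
    (i : 'I_n) (w : 'rV[R]_m) (W : 'M[R]_(n, m)) : R :=
  \sum_(q < m)
    (f i q * w 0 q
     - \big[Num.max/0]_(j < n | j != i) (f j q * W j q * w 0 q)).

Definition nash_equilibria (R : realType) (n m : nat)
    (f : 'I_n -> 'I_m -> R) : set 'M[R]_(n, m) :=
  [set W : 'M[R]_(n, m) |
     weight_profiles W /\
     forall (i : 'I_n) (w : 'rV[R]_m), weight_vectors w ->
       utility f i w W <= utility f i (row i W) W].

Definition tsupp (R : realType) (m : nat) (w : 'rV[R]_m) : {set 'I_m} :=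
  [set q | w 0 q == 1]%SET.

Definition tsupp_map (R : realType) (n m : nat) (W : 'M[R]_(n, m)) :
    {ffun 'I_n -> {set 'I_m}} :=
  [ffun i => tsupp (row i W)].

(* Blocks of a task partition may be empty, unlike in [finset.partition]. *)
Definition task_partitions (n m : nat) : set {ffun 'I_n -> {set 'I_m}} :=
  [set V : {ffun 'I_n -> {set 'I_m}} |
     (\bigcup_(i < n) V i)%SET = [set: 'I_m]%SET /\
     forall i j : 'I_n, i != j -> (V i :&: V j)%SET = finset.set0].

Definition partition_value (R : realType) (n m : nat)
    (f : 'I_n -> 'I_m -> R) (V : {ffun 'I_n -> {set 'I_m}}) : R :=
  \sum_(i < n) \sum_(q in V i) f i q.

Definition optimal_partitions (R : realType) (n m : nat)
    (f : 'I_n -> 'I_m -> R) : set {ffun 'I_n -> {set 'I_m}} :=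
  [set V : {ffun 'I_n -> {set 'I_m}} |
     task_partitions V /\
     forall V' : {ffun 'I_n -> {set 'I_m}}, task_partitions V' ->
       partition_value f V' <= partition_value f V].

(* Main.v *)
Require Import Defs.
From mathcomp Require Import all_boot all_order all_algebra.
From mathcomp Require Import classical_sets reals.

Import Order.TTheory GRing.Theory Num.Theory.
Local Open Scope ring_scope.
Local Open Scope classical_set_scope.

(** A task partition is the same thing as an assignment [p] of an owner to each
    task, and its value is [\sum_q f (p q) q].  This sum splits over the tasks,
    so handing one task to another agent changes a single summand, and in an
    optimal partition every owner is dominating for its tasks
    ([optimal_owner_dominating]).

    The equilibrium whose translated support is the partition is its indicator
    profile: the owner of [q] puts weight 1 on [q] and everybody else weight 0.
    The utility is a sum over tasks, so it suffices to compare, on each task,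
    what agent [i] earns with weight [x] to what it earns in the profile
    ([owner_profile_nash]).  An owner competes with zero weights and earns
    [f i q * x], which is largest at [x = 1].  Any other agent faces the full
    weight of a dominating owner and earns at most [(f i q - f (p q) q) * x],
    which is nonpositive, while weight 0 yields 0. *)

Definition owner_partition {n m : nat} (p : 'I_m -> 'I_n) :
    {ffun 'I_n -> {set 'I_m}} :=
  [ffun i => [set q | p q == i]%SET].

Lemma owner_partition_task_partition {n m : nat} (p : 'I_m -> 'I_n) :
  task_partitions (owner_partition p).
Proof.
split=> [|i j neq_ij].
  apply/setP => q; rewrite finset.in_setT; apply/bigcupP.
  by exists (p q); rewrite // ffunE inE.
apply/setP => q; rewrite !ffunE !inE; apply/negbTE/negP => /andP[/eqP pi /eqP pj].
by rewrite -pi -pj eqxx in neq_ij.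
Qed.

Lemma task_partition_owner {n m : nat} {V : {ffun 'I_n -> {set 'I_m}}} :
  task_partitions V -> exists p : 'I_m -> 'I_n, V = owner_partition p.
Proof.
move=> [cover disj].
have /fin_all_exists[p pV] : forall q, exists i, q \in V i.
  move=> q; have: q \in [set: 'I_m]%SET by rewrite finset.in_setT.
  by rewrite -cover => /bigcupP[i _ qVi]; exists i.
exists p; apply/ffunP => i; apply/setP => q; rewrite ffunE inE.
apply/idP/eqP => [qVi|<- //].
apply/eqP/negPn/negP => /disj/setP/(_ q).
by rewrite !inE pV qVi.
Qed.

Lemma partition_value_owner {R : realType} {n m : nat} (f : 'I_n -> 'I_m -> R)
    (p : 'I_m -> 'I_n) :
  partition_value f (owner_partition p) = \sum_(q < m) f (p q) q.
Proof.
rewrite /partition_value [RHS](partition_big p xpredT) //=.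
apply: eq_bigr => i _; apply: eq_big => [q|q]; rewrite ffunE inE //.
by move=> /eqP->.
Qed.

(** Reassigning the single task [q] to [j] leaves all other summands of the
    value unchanged, so optimality compares exactly [f j q] with
    [f (p q) q]. *)
Lemma optimal_owner_dominating {R : realType} {n m : nat}
    {f : 'I_n -> 'I_m -> R} {p : 'I_m -> 'I_n} :
  optimal_partitions f (owner_partition p) ->
  forall q, dominating f (p q) q.
Proof.
move=> [_ opt] q j.
pose p' x := if x == q then j else p x.
have := opt _ (owner_partition_task_partition p').
rewrite !partition_value_owner (bigD1 q) //= [leRHS](bigD1 q) //=.
rewrite {1}/p' eqxx (eq_bigr (fun x => f (p x) x)) ?lerD2r // => x /negbTE neq_xq.
by rewrite /p' neq_xq.
Qed.

Definition owner_profile (R : realType) {n m : nat} (p : 'I_m -> 'I_n) :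
    'M[R]_(n, m) :=
  \matrix_(i, q) (p q == i)%:R.

Lemma tsupp_owner_profile {R : realType} {n m : nat} (p : 'I_m -> 'I_n) :
  tsupp_map (owner_profile R p) = owner_partition p.
Proof.
apply/ffunP => i; apply/setP => q; rewrite !ffunE !inE !mxE.
by case: (p q == i); rewrite ?eqxx // eq_sym oner_eq0.
Qed.

Lemma owner_profile_weights {R : realType} {n m : nat} (p : 'I_m -> 'I_n) :
  weight_profiles (owner_profile R p).
Proof. by move=> i q; rewrite !mxE; case: eqP; rewrite ?lexx ler01. Qed.

(** Domination makes the owner's full weight an effective deterrent: its
    penalty outweighs whatever another agent could gain on the task.
    Nonnegativity of [f] makes weight 1 optimal for the owner, who competes
    with nobody. *)
Lemma owner_profile_nash {R : realType} {n m : nat} {f : 'I_n -> 'I_m -> R}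
    (f_ge0 : forall (i : 'I_n) (q : 'I_m), 0 <= f i q) {p : 'I_m -> 'I_n} :
  (forall q, dominating f (p q) q) ->
  nash_equilibria f (owner_profile R p).
Proof.
move=> dom; split=> [|i w w01]; first exact: owner_profile_weights.
apply: ler_sum => q _; have /andP[w_ge0 w_le1] := w01 q.
rewrite !mxE; have [pq|pq] := eqVneq (p q) i.
  (* The penalty of the deviation is nonnegative, that of the profile is 0. *)
  apply: lerB; first exact: ler_wpM2l.
  apply: (@le_trans _ _ 0); last exact: bigmax_ge_id.
  apply: bigmax_le => // j neq_ji.
  by rewrite mxE pq eq_sym (negbTE neq_ji) mulr0 mul0r.
(* The profile earns 0 here; the penalty of the deviation is bounded below by
   the term of the owner. *)
apply: (@le_trans _ _ 0).
  rewrite subr_le0; apply: (@le_trans _ _ (f (p q) q * 1 * w 0 q)).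
    by rewrite mulr1 ler_wpM2r // dom.
  have /= := @le_bigmax_cond _ _ _ 0 (p q) (fun j => j != i)
    (fun j => f j q * owner_profile R p j q * w 0 q) pq.
  by rewrite [X in _ * X * _ <= _]mxE eqxx.
rewrite mulr0 sub0r oppr_ge0; apply: bigmax_le => // j _.
by rewrite mulr0.
Qed.

Theorem mainTheorem3 (R : realType) (n m : nat) (f : 'I_n -> 'I_m -> R)
    (f_ge0 : forall (i : 'I_n) (q : 'I_m), 0 <= f i q)
    (not_all_dominating :
       forall q : 'I_m, ~ (forall i : 'I_n, dominating f i q)) :
  optimal_partitions f `<=` @tsupp_map R n m @` nash_equilibria f.
Proof.
move=> V optV; have [p defV] := task_partition_owner (proj1 optV).
rewrite {}defV in optV *.
exists (owner_profile R p); last exact: tsupp_owner_profile.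
exact: (owner_profile_nash f_ge0 (optimal_owner_dominating optV)).
Qed.
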